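(* Let $\mathbb{K}=\mathbb{R}$ or $\mathbb{K}=\mathbb{C}$. Let $P_1,\dots,P_n$ be $n$ distinct points in the affine plane $\mathbb{K}^2$, not all of them on the same line, and such that there exist two of them determining a line of unique slope. Then the number of distinct slopes of the lines determined by the $n$ points (i.e. of the lines $L_{i,j}$ through $P_i$ and $P_j$, for $1\le i<j\le n$) is at least $n$.
   Context: For $i<j$ let $L_{i,j}\subset \mathbb{K}^2$ be the line through $P_i$ and $P_j$. Embed $\mathbb{K}^2$ in the projective plane $\mathbb{P}^2(\mathbb{K})$ and let $L=\mathbb{P}^2(\mathbb{K})\setminus\mathbb{K}^2$ be the line at infinity. Two lines $L_{i,j}$ and $L_{i',j'}$ have the same slope if their closures in $\mathbb{P}^2(\mathbb{K})$ meet $L$ at the same point. The number of distinct slopes is the number $w$ of distinct points $D_1,\dots,D_w$ of $L$ obtained as intersections of $L$ with the closures $\overline{L}_{i,j}$, $1\le i<j\le n$. Two of the points, $P_i$ and $P_j$ with $i<j$, determine a line of unique slope if the point $D=L\cap\overline{L}_{i,j}$ is obtained from a unique pair of indices, i.e. $L\cap\overline{L}_{i',j'}\neq D$ for every pair $i'<j'$ with $(i',j')\ne(i,j)$ (in particular, no third point of the configuration lies on $L_{i,j}$). *)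

(* Defs.v *)
From mathcomp Require Import all_boot all_order all_algebra.
From mathcomp Require Import reals complex.

Set Implicit Arguments.
Unset Strict Implicit.
Unset Printing Implicit Defensive.

Import Order.TTheory GRing.Theory Num.Theory.
Local Open Scope ring_scope.

(* Points of the projective plane P^2(K) are the 1-dimensional subspaces of
   K^3, projective lines are the 2-dimensional ones, and a point lies on a line
   when it is included in it. *)
Section SlopeDefs.
Variable K : fieldType.
Implicit Types p q x : 'rV[K]_2.

Definition affine_line p q : 'rV[K]_2 -> Prop :=
  fun x => exists t : K, x = p + t *: (q - p).

Definition collinear (n : nat) (P : 'I_n -> 'rV[K]_2) : Prop :=
  exists p q, p <> q /\ forall i, affine_line p q (P i).

(* The embedding (x, y) |-> [x : y : 1] of K^2 in P^2(K). *)
Definition proj_point p : {vspace 'rV[K]_(2 + 1)} := <[row_mx p 1%:M]>%VS.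

(* The line [x : y : 0]. *)
Definition line_at_infinity : {vspace 'rV[K]_(2 + 1)} :=
  lker (linfun (@rsubmx K 1 2 1)).

(* For p != q, the projective line joining p and q, i.e. the closure of
   affine_line p q; see mem_closed_line and dim_closed_line below. *)
Definition closed_line p q : {vspace 'rV[K]_(2 + 1)} :=
  (proj_point p + proj_point q)%VS.

Definition slope p q : {vspace 'rV[K]_(2 + 1)} :=
  (line_at_infinity :&: closed_line p q)%VS.

(* The list, without repetition, of the points D_1, ..., D_w. *)
Definition slopes (n : nat) (P : 'I_n -> 'rV[K]_2) :
    seq {vspace 'rV[K]_(2 + 1)} :=
  undup [seq slope (P ij.1) (P ij.2)
        | ij : 'I_n * 'I_n <- enum {: 'I_n * 'I_n} & (ij.1 < ij.2)%N].

Definition unique_slope (n : nat) (P : 'I_n -> 'rV[K]_2) (i j : 'I_n) : Prop :=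
  forall i' j' : 'I_n, (i' < j')%N -> (i', j') <> (i, j) ->
    slope (P i') (P j') <> slope (P i) (P j).

Lemma mem_line_at_infinity (v : 'rV[K]_(2 + 1)) :
  (v \in line_at_infinity) = (rsubmx v == 0).
Proof. by rewrite memv_ker lfunE. Qed.

Lemma dim_proj_point p : \dim (proj_point p) = 1%N.
Proof.
rewrite dim_vline; case: eqP => // /(congr1 (@rsubmx K 1 2 1)).
rewrite row_mxKr linear0 => /matrixP/(_ 0 0)/eqP.
by rewrite !mxE eqxx oner_eq0.
Qed.

Lemma proj_point_inj : injective proj_point.
Proof.
move=> p q pq; have /vlineP[k] : row_mx p 1%:M \in proj_point q.
  by rewrite -pq memv_line.
rewrite scale_row_mx => /eq_row_mx[->] /matrixP/(_ 0 0).
by rewrite !mxE eqxx mulr1 => <-; rewrite scale1r.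
Qed.

(* K^2 is the complement of the line at infinity. *)
Lemma affine_complement (D : {vspace 'rV[K]_(2 + 1)}) : \dim D = 1%N ->
  (exists p, D = proj_point p) <-> ~~ (D <= line_at_infinity)%VS.
Proof.
move=> D1; split=> [[p ->]|].
  rewrite -memvE mem_line_at_infinity row_mxKr.
  apply/eqP => /matrixP/(_ 0 0)/eqP.
  by rewrite !mxE eqxx oner_eq0.
case/subvPn => v vD; rewrite mem_line_at_infinity => vz.
have v0 : v != 0 by apply: contraNneq vz => ->; rewrite linear0.
have {vD} -> : D = <[v]>%VS.
  by apply/esym/eqP; rewrite eqEdim -memvE vD dim_vline v0 D1.
pose z := rsubmx v 0 0.
have z0 : z != 0.
  apply: contraNneq vz => z0; apply/eqP/matrixP => i j.
  by rewrite !ord1 -/z z0 mxE.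
have vE : v = z *: row_mx (z^-1 *: lsubmx v) 1%:M.
  rewrite scale_row_mx scalerA divff // scale1r scalemx1.
  by rewrite -[LHS]hsubmxK [rsubmx v]mx11_scalar.
exists (z^-1 *: lsubmx v); apply/eqP; rewrite eqEsubv /proj_point.
rewrite -!memvE; apply/andP; split; apply/vlineP.
  by exists z.
by exists z^-1; rewrite {2}vE scalerA mulVf // scale1r.
Qed.

Lemma dim_closed_line p q : p <> q -> \dim (closed_line p q) = 2%N.
Proof.
move=> pq; rewrite /closed_line dimv_disjoint_sum ?dim_proj_point //.
apply/eqP; rewrite -subv0; apply/subvP => v /memv_capP[/vlineP[a ->]].
case/vlineP=> b; rewrite !scale_row_mx => /eq_row_mx[ab /matrixP/(_ 0 0)].
rewrite !mxE eqxx !mulr1 => eab; move: ab; rewrite -eab => ab.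
have [->|a0] := eqVneq a 0; first by rewrite !scale0r row_mx0 mem0v.
by case: pq; apply: (scalerI a0).
Qed.

Lemma mem_closed_line p q x :
  (proj_point x <= closed_line p q)%VS <-> affine_line p q x.
Proof.
rewrite -memvE; split=> [/memv_addP[u /vlineP[a ->]] [v /vlineP[b ->]]|[t ->]].
  rewrite !scale_row_mx add_row_mx => /eq_row_mx[-> /matrixP/(_ 0 0)].
  rewrite !mxE eqxx !mulr1 => ab; exists b.
  have -> : a = 1 - b by apply/eqP; rewrite eq_sym subr_eq; apply/eqP.
  by rewrite scalerBl scale1r scalerBr -addrA [- _ + _]addrC.
apply/memv_addP; exists ((1 - t) *: row_mx p 1%:M).
  by rewrite memvZ ?memv_line.
exists (t *: row_mx q 1%:M); first by rewrite memvZ ?memv_line.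
rewrite !scale_row_mx add_row_mx -scalerDl subrK scale1r.
by rewrite scalerBl scale1r scalerBr -addrA [- _ + _]addrC.
Qed.

Lemma dim_slope p q : p <> q -> \dim (slope p q) = 1%N.
Proof.
move=> pq; have dc := dim_closed_line pq.
have Lsub : ~~ (closed_line p q <= line_at_infinity)%VS.
  apply/negP => /(subv_trans (addvSl (proj_point p) (proj_point q))) pL.
  have [h _] := affine_complement (dim_proj_point p).
  by move: (h (ex_intro _ p erefl)); rewrite pL.
apply/eqP; rewrite eqn_leq; apply/andP; split.
  have: (\dim (slope p q) <= \dim (closed_line p q))%N by rewrite dimvS ?capvSr.
  rewrite dc leq_eqVlt => /orP[/eqP s2|]; last by rewrite ltnS.
  case/negP: Lsub; have /eqP <- : slope p q == closed_line p q.
    by rewrite eqEdim capvSr dc s2.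
  exact: capvSl.
have: row_mx (q - p) 0 \in slope p q.
  rewrite memv_cap mem_line_at_infinity row_mxKr eqxx /=.
  have -> : row_mx (q - p) (0 : 'M[K]_1) = row_mx q 1%:M - row_mx p 1%:M.
    by rewrite opp_row_mx add_row_mx subrr.
  by rewrite addrC memv_add ?memvN ?memv_line.
rewrite memvE => /dimvS; rewrite dim_vline.
case: eqP => // e; case: pq; apply/esym/eqP; rewrite -subr_eq0.
by move: e; rewrite -[X in _ = X]row_mx0 => /eq_row_mx[->].
Qed.

End SlopeDefs.

(* Main.v *)
(** Choose a linear coordinate [x] taking distinct values on the points, let
    [y] be another one, and consider in [K[m]] the linear forms
    [t_i = y_i - m x_i]: the slopes are the values of [m] at which two of them
    agree.  For a function [c] of the points write
    [D(c) = sum_i c_i / prod_(j != i) (t_i - t_j)], the leading divided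
    difference of [c] at the nodes [t_i], an element of [K(m)].
    Since [D(t) = 0] when [n > 2], [(m - a) D(x) = D(y - a x)] for every [a].
    The recursion of divided differences shows that [D(y - a x)] is regular at
    [a], so [D(x)] has only simple poles, all at slopes: [s D(x)] is a
    polynomial, where [s] is the product of [m - a] over the [w] slopes [a].
    For [a = 0] the same identity bounds the degree of [D(x)] by [- n].
    Finally the pair of unique slope gives [D(x)] a genuine simple pole,
    whence [D(x) != 0] and [0 <= deg (s D(x)) <= w - n]. *)
Require Import Defs.
From mathcomp Require Import all_boot all_order all_algebra.
From mathcomp Require Import reals complex.
From mathcomp Require Import ring.

Set Implicit Arguments.
Unset Strict Implicit.
Unset Printing Implicit Defensive.

Import Order.TTheory GRing.Theory Num.Theory.
Local Open Scope ring_scope.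
Local Open Scope complex_scope.

(** * Divided differences over a field *)

Section DividedDifferences.
Variables (F : fieldType) (T : finType) (t : T -> F).
Hypothesis t_inj : injective t.
Implicit Types (c : T -> F) (A : {set T}).

Definition divdiff c A : F :=
  \sum_(i in A) c i / \prod_(j in A :\ i) (t i - t j).

Lemma subt_neq0 a b : (t a - t b != 0) = (a != b).
Proof. by rewrite subr_eq0 (inj_eq t_inj). Qed.

Lemma eq_divdiff c d A : {in A, c =1 d} -> divdiff c A = divdiff d A.
Proof. by move=> cd; apply: eq_bigr => i iA; rewrite cd. Qed.

Lemma divdiffB c d A :
  divdiff (fun i => c i - d i) A = divdiff c A - divdiff d A.
Proof. by rewrite /divdiff -sumrB; apply: eq_bigr => i _; rewrite mulrBl. Qed.

Lemma divdiffZ k c A : divdiff (fun i => k * c i) A = k * divdiff c A.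
Proof. by rewrite mulr_sumr; apply: eq_bigr => i _; rewrite mulrA. Qed.

Lemma divdiff_set1 c a : divdiff c [set a] = c a.
Proof.
rewrite /divdiff big_set1 big_pred0 ?divr1 // => j.
by rewrite !inE andNb.
Qed.

(** The factor [t i - t a] kills the term of [a] and cancels against the denominator of every other
    term. *)
Lemma divdiff_setD1 c A a : a \in A ->
  divdiff (fun i => (t i - t a) * c i) A = divdiff c (A :\ a).
Proof.
move=> aA; rewrite /divdiff (big_setD1 a) //= subrr !mul0r add0r.
apply: eq_bigr => i; rewrite in_setD1 => /andP[ia iA].
rewrite [\prod_(j in A :\ i) _](big_setD1 a) /= ?in_setD1 1?eq_sym ?ia //.
have -> : A :\ i :\ a = A :\ a :\ i.
  by apply/setP => j; rewrite !in_setD1 andbCA.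
by rewrite -mulf_div divff ?mul1r // subt_neq0.
Qed.

(** Under the sum, [t a - t b] is [(t i - t b) - (t i - t a)], and each half removes one node. *)
Lemma divdiff_rec c A a b : a \in A -> b \in A ->
  (t a - t b) * divdiff c A = divdiff c (A :\ b) - divdiff c (A :\ a).
Proof.
move=> aA bA; rewrite -!divdiff_setD1 // -divdiffB -divdiffZ.
by apply: eq_divdiff => i _; ring.
Qed.

Lemma divdiff_cst (k : F) A : (1 < #|A|)%N -> divdiff (fun=> k) A = 0.
Proof.
case E : #|A| => [|[|n]] // _; elim: n => [|n IHn] in A E *.
all: have /card_gt1P[a [b [aA bA ab]]] : (1 < #|A|)%N by rewrite E.
all: move: (E); rewrite (cardsD1 a) aA => -[Ea].
all: move: (E); rewrite (cardsD1 b) bA => -[Eb].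
all: have tab : t a - t b != 0 by rewrite subt_neq0.
all: apply: (mulfI tab); rewrite mulr0 (divdiff_rec _ aA bA).
  have /eqP/cards1P[u ->] := Ea; have /eqP/cards1P[v ->] := Eb.
  by rewrite !divdiff_set1 subrr.
by rewrite !IHn ?subrr.
Qed.

Lemma divdiff_id A : (2 < #|A|)%N -> divdiff t A = 0.
Proof.
move=> A2; have /card_gt0P[a aA] := leq_trans (isT : (0 < 3)%N) A2.
rewrite (eq_divdiff (d := fun i => (t i - t a) * 1 - - t a)).
  rewrite divdiffB divdiff_setD1 // !divdiff_cst ?subrr //; first exact: ltnW.
  by move: A2; rewrite (cardsD1 a) aA.
by move=> i _; ring.
Qed.

End DividedDifferences.

(** * Regularity at a point of [K], and local divisibility of polynomials *)

Local Notation "p %:F" := (@tofrac _ p) : ring_scope.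

(** Membership in the local ring of [{poly K}] at [a]. *)
Definition regular_at (K : fieldType) (a : K) (f : {fraction {poly K}}) :
    Prop :=
  exists2 q : {poly K}, q.[a] != 0 & exists p : {poly K}, f * q%:F = p%:F.

Lemma regular_poly (K : fieldType) (a : K) (p : {poly K}) : regular_at a p%:F.
Proof.
exists 1; first by rewrite hornerC oner_eq0.
by exists p; rewrite rmorph1 mulr1.
Qed.

Lemma regularB (K : fieldType) (a : K) f g :
  regular_at a f -> regular_at a g -> regular_at a (f - g).
Proof.
move=> [q qa [p fE]] [s sa [r gE]]; exists (q * s).
  by rewrite hornerM mulf_neq0.
exists (p * s - r * q).
by rewrite tofracB !tofracM -fE -gE; ring.
Qed.

Lemma regular_unit_mul (K : fieldType) (a : K) (u : {poly K}) f :
  u.[a] != 0 -> regular_at a (u%:F * f) -> regular_at a f.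
Proof.
move=> ua [q qa [p fE]]; exists (u * q); first by rewrite hornerM mulf_neq0.
by exists p; rewrite -fE tofracM; ring.
Qed.

(* If two nodes have distinct values at [a], their difference is invertible
   near [a] and [divdiff_rec] removes one of them. *)
Lemma regular_divdiff (K : fieldType) (T : finType) (t : T -> {poly K})
    (a : K) (A : {set T}) : injective t ->
  regular_at a (divdiff (fun i => (t i)%:F) (fun i => (t i).[a]%:P%:F) A).
Proof.
move=> t_inj; have tF_inj : injective (fun i => (t i)%:F).
  by move=> i j /eqP; rewrite tofrac_eq => /eqP/t_inj.
have [n] := ubnP #|A|; elim: n => // n IHn in A * => leAn.
(* If all nodes agree at [a], the values are constant on [A]: the divided difference is 0 or, for a
   singleton, a constant polynomial. *)
have [/forall_inP cstA|] := boolP [forall i in A, forall j in A,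
    (t i).[a] == (t j).[a]].
  have [A1|A1] := ltnP 1 #|A|.
    have /card_gt0P[i iA] := ltnW A1.
    rewrite (@eq_divdiff _ _ _ _ (fun=> (t i).[a]%:P%:F)) => [|j jA].
      by rewrite divdiff_cst // -tofrac0; apply: regular_poly.
    by have /forall_inP/(_ j jA)/eqP-> := cstA i iA.
  have [->|/set0Pn[i iA]] := eqVneq A set0.
    by rewrite /divdiff big_set0 -tofrac0; apply: regular_poly.
  have /eqP/cards1P[j ->] : #|A| = 1%N.
    by apply/eqP; rewrite eqn_leq A1 card_gt0; apply/set0Pn; exists i.
  by rewrite divdiff_set1; apply: regular_poly.
case/forall_inPn => i iA /forall_inPn[j jA tij].
apply: (@regular_unit_mul _ _ (t i - t j)); first by rewrite !hornerE subr_eq0.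
rewrite tofracB (divdiff_rec tF_inj) //.
by apply: regularB; apply: IHn; move: leAn;
  [rewrite (cardsD1 j) jA | rewrite (cardsD1 i) iA].
Qed.

(** By induction the tail product divides [M]; after cancelling it, [L i] divides the cofactor times
    [q], hence the cofactor by Gauss. The factors may share roots, as happens when several pairs
    have the same slope. *)
Lemma dvdp_of_local (K : fieldType) (I : eqType) (r : seq I)
    (L : I -> {poly K}) (M : {poly K}) : (forall i, i \in r -> L i != 0) ->
  (forall i, i \in r -> exists2 q : {poly K},
     coprimep (L i) q & \prod_(k <- r) L k %| M * q) ->
  \prod_(k <- r) L k %| M.
Proof.
elim: r => [|i r IHr] L0 loc; first by rewrite big_nil dvd1p.
rewrite big_cons in loc *; set V := \prod_(k <- r) _ in loc *.
have /dvdpP[W MW] : V %| M.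
  apply: IHr => k kr; first by rewrite L0 // in_cons kr orbT.
  have [|q qk dv] := loc k; first by rewrite in_cons kr orbT.
  by exists q => //; apply: dvdp_trans dv; apply: dvdp_mull.
have V0 : V != 0.
  rewrite /V prodf_seq_neq0; apply/allP => k kr.
  by rewrite L0 // in_cons kr orbT.
have [|q iq] := loc i; first exact: mem_head.
by rewrite MW mulrAC !dvdp_mul2r // Gauss_dvdpl.
Qed.

(** * The degree count in a coordinate that separates the points *)

Section SlopeCount.
Variables (K : fieldType) (T : finType) (x y : T -> K).
Hypothesis x_inj : injective x.

Let t i : {poly K} := (y i)%:P - (x i)%:P * 'X.
Let p i := \prod_(j | j != i) (t i - t j).
(** Up to sign, the discriminant of the nodes. It is a common denominator: [num c] over [V] is the
    divided difference of [c], so the degree count stays within polynomials. *)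
Let V := \prod_i p i.
Let num (c : T -> {poly K}) := \sum_i c i * \prod_(j | j != i) p j.

Let tB i j : t i - t j = (y i - y j)%:P - (x i - x j)%:P * 'X.
Proof. by rewrite /t !polyCB; ring. Qed.

Let size_tB i j : i != j -> size (t i - t j) = 2.
Proof.
move=> ij; rewrite tB addrC -mulNr -polyCN size_MXaddC size_polyC.
by rewrite polyC_eq0 oppr_eq0 subr_eq0 (inj_eq x_inj) (negPf ij).
Qed.

Let tB_neq0 i j : i != j -> t i - t j != 0.
Proof. by move=> ij; rewrite -size_poly_gt0 size_tB. Qed.

Let tB_coprime i j a q : i != j -> (t i - t j).[a] = 0 -> q.[a] != 0 ->
  coprimep (t i - t j) q.
Proof.
move=> ij; rewrite tB; set u := y i - y j; set v := x i - x j.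
rewrite !hornerE => /eqP; rewrite subr_eq0 => /eqP -> qa.
have v0 : v != 0 by rewrite subr_eq0 (inj_eq x_inj).
have -> : (v * a)%:P - v%:P * 'X = (- v) *: ('X - a%:P).
  by rewrite -mul_polyC polyCM polyCN; ring.
by rewrite coprimepZl ?oppr_eq0 // coprimep_sym coprimep_XsubC.
Qed.

Let t_inj : injective t.
Proof.
move=> i j tij; apply/eqP/negPn/negP => /tB_neq0.
by rewrite tij subrr eqxx.
Qed.

Let tF_inj : injective (fun i => (t i)%:F).
Proof. by move=> i j /eqP; rewrite tofrac_eq => /eqP/t_inj. Qed.

Let tE i a : (t i).[a] = y i - a * x i.
Proof. by rewrite /t !hornerE mulrC. Qed.

Let p_neq0 i : p i != 0.
Proof. by apply/prodf_neq0 => j ji; rewrite tB_neq0 // eq_sym. Qed.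

Let V_neq0 : V != 0.
Proof. exact/prodf_neq0. Qed.

Let size_p i : size (p i) = #|T|.
Proof.
rewrite size_prod => [|j ji]; last by rewrite tB_neq0 // eq_sym.
rewrite (eq_bigr (fun=> 2)) => [|j ji]; last by rewrite size_tB // eq_sym.
rewrite sum_nat_const muln2 -addnn -addSn addnK.
have -> : #|(fun j => j != i)| = #|predC1 i| by apply: eq_card.
by rewrite cardC1 prednK //; apply/card_gt0P; exists i.
Qed.

Let num_divdiff c :
  divdiff (fun i => (t i)%:F) (fun i => (c i)%:F) [set: T] * V%:F = (num c)%:F.
Proof.
rewrite rmorph_sum mulr_suml; apply: eq_big => i; rewrite ?in_setT // => _.
have -> : \prod_(j in [set: T] :\ i) ((t i)%:F - (t j)%:F) = (p i)%:F.
  rewrite rmorph_prod; apply: eq_big => j.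
    by rewrite in_setD1 in_setT andbT.
  by move=> _; rewrite -tofracB.
have p0 : (p i)%:F != 0 by rewrite tofrac_eq0.
by rewrite /= {1}/V (bigD1 i) //= !tofracM mulrA divfK.
Qed.

(* [y i - a * x i] is the value of [t i] at [a], and the divided difference
   of the nodes [t i] themselves vanishes. *)
Let num_shift a : (2 < #|T|)%N ->
  ('X - a%:P) * num (fun i => (x i)%:P) = num (fun i => (t i).[a]%:P).
Proof.
move=> T3; have num_t : num t = 0.
  apply/eqP; rewrite -tofrac_eq0 -num_divdiff.
  by rewrite (divdiff_id tF_inj) ?mul0r // cardsT.
rewrite -[LHS]add0r -num_t mulr_sumr -big_split; apply: eq_bigr => i _ /=.
by rewrite tE /t polyCB polyCM; ring.
Qed.

Let dvdp_num a :
  exists2 q : {poly K}, q.[a] != 0 & V %| num (fun i => (t i).[a]%:P) * q.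
Proof.
have [q qa [r]] := regular_divdiff a [set: T] t_inj.
set D := divdiff _ _ _ => DE.
exists q => //; apply/dvdpP; exists r; apply/eqP; rewrite -tofrac_eq.
rewrite !tofracM -num_divdiff -DE; apply/eqP; rewrite -/D; ring.
Qed.

(** Each term is a scalar times [V] deprived of one factor [p i], whose degree is [#|T| - 1]. *)
Let size_num c : (size (num (fun i => (c i)%:P)) + #|T| <= (size V).+1)%N.
Proof.
have T0 : (#|T| <= (size V).+1)%N.
  have [->//|T0] := posnP #|T|; have /card_gt0P[i _] := T0.
  by rewrite -(size_p i) leqW // dvdp_leq // /V (bigD1 i) //= dvdp_mulr.
rewrite addnC -leq_subRL //; apply: leq_trans (size_sum _ _ _) _.
apply/bigmax_leqP => i _; rewrite leq_subRL //.
rewrite mul_polyC.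
have -> : size V = (size (p i * \prod_(j | j != i) p j)).
  by rewrite /V (bigD1 i).
rewrite size_mul //; last exact/prodf_neq0.
rewrite size_p; apply: leq_trans (leqSpred _).
by rewrite leq_add2l size_scale_leq.
Qed.

Variables (i0 j0 : T) (a0 : K).
Hypothesis ij0 : i0 != j0.
Hypothesis node0 : forall i j, i != j ->
  y i - a0 * x i = y j - a0 * x j <-> [set i; j] = [set i0; j0].

(* At [a0] each term of [num x] vanishes to order 2, except those of [i0] and
   [j0], which vanish to order 1 and do not cancel. *)
Let num_neq0 : num (fun i => (x i)%:P) != 0.
Proof.
have t0 : (t i0 - t j0).[a0] = 0.
  by rewrite hornerD hornerN !tE; apply/eqP; rewrite subr_eq0; apply/eqP/node0.
have tn i j : i != j -> [set i; j] != [set i0; j0] -> (t i - t j).[a0] != 0.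
  move=> ij; apply: contra => /eqP; rewrite hornerD hornerN !tE => /eqP.
  by rewrite subr_eq0 => /eqP/(node0 ij)->.
have ji0 : j0 != i0 by rewrite eq_sym.
pose e i := \prod_(j | (j != i0) && (j != j0)) (t i - t j).
pose R := \prod_(j | (j != i0) && (j != j0)) p j.
pose W := \sum_(i | (i != i0) && (i != j0))
  (x i)%:P * \prod_(j | [&& j != i, j != i0 & j != j0]) p j.
have pi0 : p i0 = (t i0 - t j0) * e i0 by rewrite /p (bigD1 j0).
have pj0 : p j0 = - ((t i0 - t j0) * e j0).
  rewrite -mulNr opprB [LHS](bigD1 i0) //=; congr (_ * _).
  by apply: eq_bigl => j; rewrite andbC.
have prod_i0 : \prod_(j | j != i0) p j = p j0 * R by rewrite (bigD1 j0).
have prod_j0 : \prod_(j | j != j0) p j = p i0 * R.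
  rewrite (bigD1 i0) //=; congr (_ * _).
  by apply: eq_bigl => j; rewrite andbC.
have prod_i i : i != i0 -> i != j0 -> \prod_(j | j != i) p j =
    p i0 * p j0 * \prod_(j | [&& j != i, j != i0 & j != j0]) p j.
  move=> ii ij; rewrite (bigD1 i0) 1?eq_sym //= (bigD1 j0) /=; last first.
    by rewrite ji0 eq_sym ij.
  by rewrite mulrA; congr (_ * _); apply: eq_bigl => j; rewrite andbA.
have numE : num (fun i => (x i)%:P) = (t i0 - t j0) *
    (R * ((x j0)%:P * e i0 - (x i0)%:P * e j0)
     - (t i0 - t j0) * e i0 * e j0 * W).
  rewrite /num (bigD1 i0) // (bigD1 j0) //= prod_i0 prod_j0.
  rewrite (eq_bigr (fun i => p i0 * p j0 * ((x i)%:P *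
      \prod_(j | [&& j != i, j != i0 & j != j0]) p j))) => [|i /andP[ii ij]].
    by rewrite -mulr_sumr -/W pi0 pj0; ring.
  by rewrite prod_i // mulrCA.
rewrite numE mulf_neq0 ?tB_neq0 //.
(* Since [t i0] and [t j0] agree at [a0], the cofactor of [t i0 - t j0] takes there the value of
   [R * e i0] times [x j0 - x i0]. *)
have eE : (e j0).[a0] = (e i0).[a0].
  rewrite !horner_prod; apply: eq_bigr => j _.
  move/eqP: t0; rewrite hornerD hornerN subr_eq0 => /eqP ti.
  by rewrite hornerD [RHS]hornerD ti.
have e0 : (e i0).[a0] != 0.
  rewrite horner_prod; apply/prodf_neq0 => j /andP[ji jj].
  apply: tn; first by rewrite eq_sym.
  by apply: contraNneq jj => /setP/(_ j); rewrite set22 !inE (negPf ji).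
have R0 : R.[a0] != 0.
  rewrite horner_prod; apply/prodf_neq0 => j /andP[ji jj].
  rewrite horner_prod; apply/prodf_neq0 => k kj.
  apply: tn; first by rewrite eq_sym.
  by apply: contraTneq (set21 j k) => ->; rewrite !inE negb_or ji.
apply: contraTneq (eqxx (0 : K)) => /(congr1 (horner^~ a0)) /=.
rewrite horner0 hornerD hornerN !hornerM t0 hornerD hornerN.
rewrite !hornerM !hornerC eE.
rewrite !mul0r subr0 -mulrBl => /eqP.
rewrite !mulf_eq0 (negPf R0) (negPf e0) orbF subr_eq0.
by rewrite (inj_eq x_inj) (negPf ji0).
Qed.

Lemma card_le_slopes (s : seq K) : (2 < #|T|)%N ->
  (forall i j, i != j -> exists2 a, a \in s & y i - a * x i = y j - a * x j) ->
  (#|T| <= size s)%N.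
Proof.
move=> T3 sP; pose S := \prod_(a <- s) ('X - a%:P).
pose N := num (fun i => (x i)%:P).
have dvV : V %| S * N.
  rewrite /V /p pair_big_dep /= -big_filter.
  apply: dvdp_of_local => -[i j]; rewrite mem_filter /= => /andP[ji _].
    by rewrite tB_neq0 // eq_sym.
  have ij : i != j by rewrite eq_sym.
  have [a sa aij] := sP i j ij; have [q qa qV] := dvdp_num a.
  exists q.
    by apply: tB_coprime qa; rewrite // hornerD hornerN !tE aij subrr.
  rewrite big_filter -(pair_big_dep xpredT (fun i j => j != i)
    (fun i j => t i - t j)) /=.
  (* One factor of [S] at the slope [a] of the pair turns [N] into the numerator of a fraction
     regular at [a]. *)
  have -> : S * N * q =
      \prod_(b <- rem a s) ('X - b%:P) * (('X - a%:P) * N * q).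
    by rewrite /S (big_rem a) //=; ring.
  by rewrite num_shift // dvdp_mull.
have N0 : N != 0 := num_neq0.
have S0 : S != 0 by rewrite monic_neq0 // monic_prod_XsubC.
(* Bounding ['X * N], the shift at 0, instead of [N] gains the one degree that makes the final count
   sharp. *)
have sizeN : (size N + #|T| <= size V)%N.
  have := size_num (fun i => (t i).[0]); rewrite -num_shift // subr0.
  by rewrite mulrC size_mulX // addSn ltnS.
have := dvdp_leq (mulf_neq0 S0 N0) dvV.
rewrite size_mul // size_prod_XsubC addSn /=.
by move/(leq_trans sizeN); rewrite [(size s + _)%N]addnC leq_add2l.
Qed.

End SlopeCount.

(** * Generic scalars, and slopes as directions at infinity *)

Lemma exists_avoiding (K : fieldType) (s : seq K) :
  [pchar K] =i pred0 -> exists k : K, k \notin s.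
Proof.
move/pcharf0P => charK; pose r := [seq (m%:R : K) | m <- iota 0 (size s).+1].
have natr_inj : injective (fun m => m%:R : K).
  move=> m n; wlog mn : m n / (m <= n)%N => [sym|] mnE.
    by case/orP: (leq_total m n) => /sym; [apply | move->].
  apply/eqP; rewrite eqn_leq mn -subn_eq0 -charK natrB //.
  by move: mnE => /= ->; rewrite subrr.
have /allPn[k _ ks] : ~~ all (mem s) r; last by exists k.
apply/negP => /allP rs; have: (size r <= size s)%N.
  by apply: uniq_leq_size rs; rewrite map_inj_uniq ?iota_uniq.
by rewrite size_map size_iota ltnn.
Qed.

Lemma slopeE (K : fieldType) (p q : 'rV[K]_2) : p <> q ->
  slope p q = <[row_mx (q - p) 0]>%VS.
Proof.
move=> pq; apply/esym/eqP; rewrite eqEdim -memvE dim_slope // dim_vline.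
apply/andP; split; last first.
  case: eqP => // e; case: pq; apply/esym/eqP; rewrite -subr_eq0.
  by move: e; rewrite -[X in _ = X]row_mx0 => /eq_row_mx[->].
rewrite memv_cap mem_line_at_infinity row_mxKr eqxx /=.
have -> : row_mx (q - p) (0 : 'M[K]_1) = row_mx q 1%:M - row_mx p 1%:M.
  by rewrite opp_row_mx add_row_mx subrr.
by rewrite addrC memv_add ?memvN ?memv_line.
Qed.

Lemma eq_slope (K : fieldType) (k : K) (p q p' q' : 'rV[K]_2) :
  p <> q -> p' <> q' -> q - p = k *: (q' - p') -> slope p q = slope p' q'.
Proof.
move=> pq pq' E; apply/eqP; rewrite eqEdim !dim_slope // leqnn andbT.
rewrite !slopeE // -memvE E -[0](scaler0 _ k) -scale_row_mx.
by rewrite memvZ // scaler0 memv_line.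
Qed.

Lemma slopeC (K : fieldType) (p q : 'rV[K]_2) : slope p q = slope q p.
Proof. by rewrite /slope /closed_line addvC. Qed.

Lemma mem_slopes (K : fieldType) (n : nat) (P : 'I_n -> 'rV[K]_2) (i j : 'I_n) :
  i != j -> slope (P i) (P j) \in slopes P.
Proof.
wlog ij : i j / (i < j)%N => [sym ij|_].
  have [|ji|/val_inj ijE] := ltngtP i j; first by move/sym; apply.
    by rewrite slopeC sym // eq_sym.
  by rewrite ijE eqxx in ij.
rewrite mem_undup; apply/mapP; exists (i, j) => //.
by rewrite mem_filter ij mem_enum.
Qed.

(** Non-collinearity enters here: two points alone would lie on the line joining them. *)
Lemma card_ord_gt2 (K : fieldType) (n : nat) (P : 'I_n -> 'rV[K]_2)
    (i j : 'I_n) :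
  injective P -> ~ collinear P -> i != j -> (2 < n)%N.
Proof.
move=> P_inj Pcol ij; rewrite ltnNge; apply/negP => n2; apply: Pcol.
exists (P i), (P j); split=> [/P_inj/eqP|k]; first by rewrite (negPf ij).
have : k \in [set i; j].
  have /eqP -> : [set i; j] == [set: 'I_n]; last exact: in_setT.
  by rewrite eqEcard subsetT cards2 ij cardsT card_ord.
case/set2P => ->; [exists 0 | exists 1]; first by rewrite scale0r addr0.
by rewrite scale1r addrC subrK.
Qed.

(** * Slopes as scalars in a generic coordinate, and the conclusion *)

Section GenericCoordinate.
Variables (K : fieldType) (n : nat) (P : 'I_n -> 'rV[K]_2) (lam : K).
Hypothesis P_inj : injective P.

Definition shear (v : 'rV[K]_2) := v 0 0 + lam * v 0 1.
Hypothesis shear_inj : injective (shear \o P).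

(** The ratio is homogeneous of degree 0, so any nonzero vector of the projective point [D] gives
    the same scalar. *)
Definition slope_coord (D : {vspace 'rV[K]_(2 + 1)}) : K :=
  let v := @lsubmx K 1 2 1 (vpick D) in v 0 1 / shear v.

Let shearB u v : shear (u - v) = shear u - shear v.
Proof. by rewrite /shear !mxE; ring. Qed.

Let shearZ k v : shear (k *: v) = k * shear v.
Proof. by rewrite /shear !mxE; ring. Qed.

Let shearP_neq0 i j : i != j -> shear (P i) - shear (P j) != 0.
Proof. by rewrite subr_eq0 (inj_eq shear_inj). Qed.

Let P_neq i j : i != j -> P i <> P j.
Proof. by move=> ij /P_inj/eqP; rewrite (negPf ij). Qed.

Lemma slope_coordE i j : i != j -> slope_coord (slope (P i) (P j)) =
  (P i 0 1 - P j 0 1) / (shear (P i) - shear (P j)).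
Proof.
move=> ij; rewrite slopeC slopeE; last by apply: P_neq; rewrite eq_sym.
rewrite /slope_coord; set D := <[_]>%VS.
have /vlineP[k kE] : vpick D \in D by apply: memv_pick.
have k0 : k != 0.
  apply: contraTneq (eqxx (0 : K)) => k0; move/eqP: kE.
  rewrite k0 scale0r vpick0 -dimv_eq0 /D -slopeE; last first.
    by apply: P_neq; rewrite eq_sym.
  by rewrite dim_slope //; apply: P_neq; rewrite eq_sym.
rewrite kE scale_row_mx row_mxKl shearZ shearB !mxE.
by rewrite -mulf_div divff ?mul1r.
Qed.

Let alignedE a i j : i != j ->
  P i 0 1 - a * shear (P i) = P j 0 1 - a * shear (P j) <->
  a = (P i 0 1 - P j 0 1) / (shear (P i) - shear (P j)).
Proof.
move=> ij; have h := shearP_neq0 ij; split=> [E|->].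
  apply/(mulIf h); rewrite divfK // mulrBr; apply/eqP; rewrite -subr_eq0.
  move/eqP: E; rewrite -subr_eq0 => /eqP E; apply/eqP.
  by rewrite -[RHS]oppr0 -E; ring.
by field.
Qed.

Lemma card_le_slopes_shear (i0 j0 : 'I_n) : (2 < n)%N -> (i0 < j0)%N ->
  unique_slope P i0 j0 -> (n <= size (slopes P))%N.
Proof.
move=> n3 ij0 uniq0; have ij0' : i0 != j0 by rewrite -val_eqE ltn_eqF.
rewrite -[n in (n <= _)%N]card_ord -(size_map slope_coord).
apply: (@card_le_slopes _ _ _ (fun i => P i 0 1) shear_inj i0 j0
  (slope_coord (slope (P i0) (P j0)))) => //; last 2 first.
- by rewrite card_ord.
- move=> i j ij; exists (slope_coord (slope (P i) (P j))).
    by rewrite map_f // mem_slopes.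
  by apply/alignedE => //; apply: slope_coordE.
move=> i j ij /=; rewrite alignedE // slope_coordE //; split=> [E|]; last first.
  move=> E; have: i \in [set i0; j0] by rewrite -E set21.
  have: j \in [set i0; j0] by rewrite -E set22.
  move=> /set2P[] jE /set2P[] iE; rewrite {}iE {}jE ?eqxx // in ij *.
  by rewrite -[RHS]divrNN !opprB.
have {E} : slope (P i) (P j) = slope (P i0) (P j0).
  have h := shearP_neq0 ij; have h0 := shearP_neq0 ij0'.
  (* The ratio of the two directions is read on [shear]; equality of the slope coordinates carries
     it to the second coordinate, and undoing the shear to the first. *)
  pose k := (shear (P i) - shear (P j)) / (shear (P i0) - shear (P j0)).
  apply: (eq_slope (P_neq ij) (P_neq ij0') (k := k)).
  have E1 : P i 0 1 - P j 0 1 = k * (P i0 0 1 - P j0 0 1).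
    by rewrite /k mulrAC -mulrA E mulrC divfK.
  have E0 : P i 0 0 - P j 0 0 = k * (P i0 0 0 - P j0 0 0).
    have -> : P i 0 0 - P j 0 0 =
      (shear (P i) - shear (P j)) - lam * (P i 0 1 - P j 0 1).
      by rewrite /shear; ring.
    have -> : P i0 0 0 - P j0 0 0 =
      (shear (P i0) - shear (P j0)) - lam * (P i0 0 1 - P j0 0 1).
      by rewrite /shear; ring.
    by rewrite E1 /k; field.
  apply/rowP => l; rewrite !mxE; have [->|l0] := eqVneq l 0.
    by rewrite -opprB E0; ring.
  have -> : l = 1 by apply/val_inj; case: l l0 => -[|[|]].
  by rewrite -opprB E1; ring.
(* [unique_slope] speaks of increasing pairs, the goal of unordered ones. *)
wlog lij : i j ij / (i < j)%N => [sym E|E].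
  have [|ji|/val_inj ijE] := ltngtP i j; first by move/sym; apply.
    by rewrite setUC sym // 1?eq_sym // slopeC.
  by rewrite ijE eqxx in ij.
have [[-> ->] //|ne] := eqVneq (i, j) (i0, j0).
by case: (uniq0 i j lij _ E); apply/eqP.
Qed.

End GenericCoordinate.

Theorem theorem1p1 (R : realType) (K : fieldType)
    (hK : K = R :> fieldType \/ K = R[i] :> fieldType)
    (n : nat) (P : 'I_n -> 'rV[K]_2)
    (P_distinct : injective P)
    (P_not_collinear : ~ collinear P)
    (P_unique : exists i j : 'I_n, (i < j)%N /\ unique_slope P i j) :
  (n <= size (slopes P))%N.
Proof.
have [i0 [j0 [ij0 uniq0]]] := P_unique.
have ij : i0 != j0 by rewrite -val_eqE ltn_eqF.
have n3 := card_ord_gt2 P_distinct P_not_collinear ij.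
have K0 : [pchar K] =i pred0 by case: hK => ->; apply: pchar_num.
(* These are the values of [lam] for which two points with distinct second coordinates get the same
   shear. Pairs with equal second coordinates only contribute the default value 0; [shear] separates
   their points for every [lam]. *)
have [lam lamP] := exists_avoiding
  [seq - (P ij.1 0 0 - P ij.2 0 0) / (P ij.1 0 1 - P ij.2 0 1)
    | ij : 'I_n * 'I_n] K0.
apply: (card_le_slopes_shear (lam := lam) P_distinct _ n3 ij0 uniq0) =>
  i j /= E.
have [P1|P1] := eqVneq (P i 0 1) (P j 0 1).
  apply: P_distinct; apply/rowP => k; have [->|k0] := eqVneq k 0.
    by move: E; rewrite /shear P1 => /addIr.
  by have -> : k = 1 by apply/val_inj; case: k k0 => -[|[|]].
case/negP: lamP; apply/mapP; exists (i, j); first by rewrite mem_enum.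
apply/(mulIf (_ : P i 0 1 - P j 0 1 != 0)); rewrite ?subr_eq0 //=.
rewrite divfK ?subr_eq0 //.
by move/eqP: E; rewrite -subr_eq0 /shear => /eqP E; apply/eqP;
  rewrite -subr_eq0 -[X in _ == X]E; apply/eqP; ring.
Qed.
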